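(* Let $C^3_3$ be the $3$-graph with edges $\{1,2,3\},\{3,4,5\},\{5,6,1\}$, and let $G$ be a $C^3_3$-free $3$-graph. Then $\lambda(G)\le\lambda(K^3_5)=\frac{2}{25}$, and equality holds if and only if $G$ contains $K^3_5$ as a subgraph.
   Context: For a $3$-graph $G$ on $[n]$, $\lambda(G)=\max\{\sum_{e\in E(G)}\prod_{i\in e}x_i: x_i\ge0,\ \sum_ix_i=1\}$ is its Lagrangian. $K^3_5$ is the complete $3$-graph on $5$ vertices. $G$ is $F$-free if it has no subgraph isomorphic to $F$. *)

(* Defs.v *)
From HB Require Import structures.
From mathcomp Require Import all_boot all_order all_algebra.
From mathcomp Require Import all_classical all_reals all_analysis.

Set Implicit Arguments.
Unset Strict Implicit.
Unset Printing Implicit Defensive.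

Import Order.TTheory GRing.Theory Num.Theory.
Import numFieldNormedType.Exports.

Local Open Scope ring_scope.

(* Vertices are numbered 0, ..., n-1. *)
Record graph3 (n : nat) : Type := Graph3 {
  edges : {set {set 'I_n}};
  card_edge : forall e : {set 'I_n}, e \in edges -> #|e| = 3%N
}.

(* An injective edge-preserving vertex map is an isomorphism of F onto a
   subgraph of G, not necessarily induced. *)
Definition contains (m n : nat) (F : graph3 m) (G : graph3 n) : Prop :=
  exists f : 'I_m -> 'I_n, injective f /\
    forall e : {set 'I_m}, e \in edges F -> (f @: e)%SET \in edges G.

Definition subgraph_free (m n : nat) (F : graph3 m) (G : graph3 n) : Prop :=
  ~ contains F G.

Definition complete3_edges (n : nat) : {set {set 'I_n}} :=
  [set e : {set 'I_n} | #|e| == 3%N]%SET.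

Lemma complete3_card (n : nat) (e : {set 'I_n}) :
  e \in complete3_edges n -> #|e| = 3%N.
Proof. by rewrite inE => /eqP. Qed.

Definition complete3 (n : nat) : graph3 n := Graph3 (@complete3_card n).

Definition C33_edges : {set {set 'I_6}} :=
  let v (k : nat) : 'I_6 := inord k in
  [set [set v 0; v 1; v 2]; [set v 2; v 3; v 4]; [set v 4; v 5; v 0]]%N%SET.

Lemma C33_card (e : {set 'I_6}) : e \in C33_edges -> #|e| = 3%N.
Proof.
by rewrite !inE => /orP[/orP[]|] /eqP ->;
  rewrite -finset.setUA cardsU1 cards2 !inE -!val_eqE /= !inordK.
Qed.

Definition C33 : graph3 6 := Graph3 C33_card.

Section Lagrangian.
Variables (R : realType) (n : nat).
Local Open Scope classical_set_scope.

Definition std_simplex : set 'rV[R]_n :=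
  [set x | (forall i, 0 <= x ord0 i) /\ \sum_i x ord0 i = 1].

Definition lagrange_poly (G : graph3 n) (x : 'rV[R]_n) : R :=
  \sum_(e in edges G) \prod_(i in e) x ord0 i.

(* For n > 0 this supremum is a maximum, see lagrangian_max; for n = 0 the
   std_simplex is empty and the value is 0. *)
Definition lagrangian (G : graph3 n) : R := sup (lagrange_poly G @` std_simplex).

Lemma continuous_lagrange_poly (G : graph3 n) : continuous (lagrange_poly G).
Proof.
apply: continuous_big; first exact: add_continuous.
move=> e _; apply: continuous_big; first exact: mul_continuous.
by move=> i _; exact: coord_continuous.
Qed.

Lemma compact_simplex : compact std_simplex.
Proof.
pose cube : set 'rV[R]_n := [set x | forall i, `[0, 1] (x ord0 i)].
apply: (@subclosed_compact _ _ cube).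
- rewrite [X in closed X](_ : _ =
    \bigcap_(i in [set: 'I_n]) ((fun x : 'rV[R]_n => x ord0 i) @^-1` [set y | 0 <= y])
    `&` ((fun x : 'rV[R]_n => \sum_i x ord0 i) @^-1` [set y | y = 1])).
    apply: closedI.
      apply: closed_bigI => i _; apply: preimage_closed; last exact: closed_ge.
      by move=> x _; exact: coord_continuous.
    apply: preimage_closed; last exact: closed_eq.
    move=> x _; apply: continuous_big; first exact: add_continuous.
    by move=> i _; exact: coord_continuous.
  by apply/seteqP; split=> x /= [x0 x1]; split=> // i; [move=> _|]; exact: x0.
- by apply: (@rV_compact R n (fun=> `[0, 1])) => i; exact: segment_compact.
- move=> x [x0 x1] i /=; rewrite in_itv /= x0 -x1 (bigD1 i) //= lerDl.
  exact: sumr_ge0.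
Qed.

Lemma lagrangian_max (G : graph3 n) : (0 < n)%N ->
  exists2 x, std_simplex x & lagrangian G = lagrange_poly G x /\
    forall y, std_simplex y -> lagrange_poly G y <= lagrange_poly G x.
Proof.
move=> n_gt0.
have s0 : std_simplex !=set0.
  exists (delta_mx ord0 (Ordinal n_gt0)); split=> [i|].
    by rewrite mxE ler0n.
  rewrite (bigD1 (Ordinal n_gt0)) //= mxE !eqxx big1 ?addr0// => i /negPf ni.
  by rewrite mxE ni andbF.
have [x /[!inE] xs xmax] := compact_EVT_max s0 compact_simplex
  (continuous_subspaceT (@continuous_lagrange_poly G)).
have {}xmax y : std_simplex y -> lagrange_poly G y <= lagrange_poly G x.
  by move=> ys; apply: xmax; rewrite inE.
exists x => //; split=> //; apply/eqP; rewrite eq_le; apply/andP; split.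
  apply: ge_sup; first by exists (lagrange_poly G x), x.
  by move=> _ [y ys <-]; exact: xmax.
apply: ub_le_sup; last by exists x.
by exists (lagrange_poly G x) => _ [y ys <-]; exact: xmax.
Qed.

End Lagrangian.

(* Main.v *)
Require Import Defs.
From mathcomp Require Import all_boot all_order all_algebra.
From mathcomp Require Import ring lra.

(** Fix a nonnegative weighting and let [S] be its support. If no edge contains
    two given vertices of [S], the weight polynomial is linear when mass moves
    between them, so one of them can be emptied without loss; by induction on
    [#|S|] we may assume that every pair of [S] lies in an edge. If [#|S| <= 5],
    Newton's identities and Cauchy-Schwarz bound the third elementary symmetric
    function. If [#|S| >= 6], take a pair [uv] of maximal codegree. Avoiding
    loose triangles forces [uvw] to be an edge for every other [w], and then
    either all edges share a vertex, or every edge contains both or none of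
    [u], [v], or for a further pair [wp] every edge contains [uv], contains
    [wp], or misses all four vertices. The first case gives at most
    [2/27 < 2/25]; in the others, delete the pairs and use induction. *)

Set Implicit Arguments.
Unset Strict Implicit.
Unset Printing Implicit Defensive.

Import Order.TTheory GRing.Theory Num.Theory.

(** * Triple systems covering all pairs *)

Lemma card_avoid (T : finType) (S : {set T}) (l : seq T) :
  (size l < #|S|)%N -> exists2 x, x \in S & x \notin l.
Proof.
move=> ltlS; have /subsetPn[x xS xl] : ~~ (S \subset l).
  apply: contraL ltlS => /subset_leq_card /leq_trans /(_ (card_size l)).
  by rewrite leqNgt.
by exists x.
Qed.

Section Structure.
Variables (T : finType) (S : {set T}) (E : T -> T -> T -> bool).
Hypothesis Eswap : forall a b c, E a b c -> E b a c.
Hypothesis Erot : forall a b c, E a b c -> E b c a.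
Hypothesis Eneq : forall a b c, E a b c -> a <> b.
Hypothesis ES : forall a b c, E a b c -> a \in S.
Hypothesis Ecover : forall a b, a \in S -> b \in S -> a <> b -> exists c, E a b c.
Hypothesis Efree : forall a p b q c r, uniq [:: a; p; b; q; c; r] ->
  E a p b -> E b q c -> E c r a -> False.

(** Of the fifteen distinctness conditions on six vertices, nine hold inside the three edges; only
    the six across edges remain to be supplied. *)
Lemma no_triangle x y z p q r : E x p y -> E y q z -> E z r x ->
  p <> q -> q <> r -> r <> p -> p <> z -> q <> x -> r <> y -> False.
Proof.
move=> e1 e2 e3 pq qr rp pz qx ry.
apply: (@Efree x p y q z r) => //.
have := (Eneq e1, Eneq (Erot e1), Eneq (Erot (Erot e1)),
         (Eneq e2, Eneq (Erot e2), Eneq (Erot (Erot e2))),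
         (Eneq e3, Eneq (Erot e3), Eneq (Erot (Erot e3)))).
case=> [[[[h1 h2] h3] [[h4 h5] h6]] [[h7 h8] h9]].
rewrite /= !inE !negb_or !andbT.
by do !(apply/andP; split); apply/eqP => ?; subst; congruence.
Qed.

Definition link u v := [set w | E u v w].

Ltac edge := match goal with
  | H : is_true (E _ _ _) |- _ => solve
    [ exact: H | exact: (Eswap H) | exact: (Erot H) | exact: (Erot (Erot H))
    | exact: (Eswap (Erot H)) | exact: (Eswap (Erot (Erot H))) ]
  end.

Ltac new_neq a b pf := lazymatch goal with
  | _ : a <> b |- _ => fail
  | _ => move: pf => ?
  end.

Ltac neqs := repeat match goal with
  | H : is_true (E ?a ?b ?c) |- _ => first
    [ new_neq a b (Eneq H) | new_neq b c (Eneq (Erot H))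
    | new_neq c a (Eneq (Erot (Erot H))) ]
  end.

Ltac triangle x y z p q r :=
  exfalso; apply: (@no_triangle x y z p q r); (try edge); neqs; congruence.

Lemma max_pair_full u v : (6 <= #|S|)%N -> u \in S -> v \in S -> u <> v ->
  (forall a b, (#|link a b| <= #|link u v|)%N) ->
  forall z, z \in S -> z <> u -> z <> v -> E u v z.
Proof.
move=> S6 uS vS uv umax.
have [w0 e0] := Ecover uS vS uv.
have split z : z \in S -> z <> u -> z <> v -> ~ E u v z ->
  exists p q, [/\ E u z p, E v z q, p <> q & forall w, E u v w -> w = p \/ w = q].
  move=> zS zu zv nz.
  have [p ep] : exists p, E u z p by apply: Ecover => //; congruence.
  have [q eq] : exists q, E v z q by apply: Ecover => //; congruence.
  (* If [uz] and [vz] have distinct third vertices [p'] and [q'], any edge [uvw] with [w] different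
     from both closes a loose triangle on [u], [z], [v]. *)
  have [/existsP[p' /existsP[q' /and3P[ep' eq' /eqP pq']]]|] :=
    boolP [exists p', exists q', [&& E u z p', E v z q' & p' != q']].
    exists p', q'; split=> // w ew.
    case: (eqVneq w p') => [|/eqP wp]; first by left.
    case: (eqVneq w q') => [|/eqP wq]; first by right.
    have p'v : p' <> v by move=> h; subst; apply: nz; edge.
    have q'u : q' <> u by move=> h; subst; apply: nz; edge.
    have wz : w <> z by move=> h; subst.
    by triangle u z v p' q' w.
  move=> /existsPn nex.
  have same p' q' : E u z p' -> E v z q' -> p' = q'.
    move=> ep' eq'; have := nex p' => /existsPn /(_ q').
    by rewrite ep' eq' /= negbK => /eqP.
  (* Now [p] is the only neighbour of [uz] and of [vz], so every edge on [zw]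
     with [uvw] an edge is [zwp], and [zp] has larger codegree than [uv]. *)
  have pq := same _ _ ep eq; subst q.
  have : (#|u |: (v |: (link u v :\ p))| <= #|link z p|)%N.
    apply/subset_leq_card/subsetP => w; rewrite !inE => /orP[/eqP->|/orP[/eqP->|]].
    - by edge.
    - by edge.
    case/andP=> /eqP wp ew.
    have wz : z <> w by move=> h; subst.
    have [r er] : exists r, E z w r by apply: Ecover => //; apply: (@ES _ u v); edge.
    case: (eqVneq r p) => [<-|/eqP rp]; first by edge.
    have rv : r <> v.
      move=> h; subst; apply: wp; symmetry; apply: same => //; edge.
    have ru : r <> u.
      move=> h; subst; apply: wp; apply: (same w p) => //; edge.
    have pv : p <> v by move=> h; subst; apply: nz; edge.
    by triangle z u w p v r.
  rewrite !cardsU1 !inE.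
  have -> : E u v v = false by apply/negP => h; neqs; congruence.
  have -> : E u v u = false by apply/negP => h; neqs; congruence.
  have -> : (u == v) = false by apply/eqP.
  (* [link z p] has at least [2 + #|link u v :\ p|] elements, more than [link u v] can have, against
     maximality. *)
  rewrite !andbF /= => le1; have := leq_trans le1 (umax z p).
  by rewrite [in X in (_ <= X)%N -> _](cardsD1 p) addnA leq_add2r leqNgt ltnS leq_b1.
move=> z zS zu zv; apply/negPn/negP => /negP nz.
have [p [q [ep eq pq Npq]]] := split _ zS zu zv nz.
(* A sixth vertex [z'] is not in an edge with [uv] either, so [split] applies to it as well. *)
have [z' z'S] := @card_avoid _ S [:: u; v; z; p; q] S6.
rewrite !inE !negb_or => /and5P[/eqP z'u /eqP z'v /eqP z'z /eqP z'p /eqP z'q].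
have nz' : ~ E u v z' by move=> /Npq[].
have [p' [q' [ep' eq' pq' Npq']]] := split _ z'S z'u z'v nz'.
(* If [uvp] is an edge, then [up] has the neighbours [v] and [z]; if [uvq] is one, then [vq] has [u]
   and [z]. Maximality passes this to [uv], whose link is then exactly [p], [q]. *)
have D2 : (1 < #|link u v|)%N.
  have [e1|e1] := Npq _ e0; subst w0.
    apply: leq_trans (umax u p); rewrite (cardD1 v) (cardD1 z) !inE.
    have -> : E u p v by edge.
    have -> : E u p z by edge.
    by have /eqP -> : z <> v by congruence.
  apply: leq_trans (umax v q); rewrite (cardD1 u) (cardD1 z) !inE.
  have -> : E v q u by edge.
  have -> : E v q z by edge.
  by have /eqP -> : z <> u by congruence.
have Nsub : link u v \subset [set p; q].
  by apply/subsetP => w; rewrite !inE => /Npq[] ->; rewrite eqxx ?orbT.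
have /setP Neq : link u v = [set p; q].
  by apply/eqP; rewrite eqEcard Nsub cards2; case: eqP.
have eup : E u v p by have := Neq p; rewrite !inE eqxx.
have euq : E u v q by have := Neq q; rewrite !inE eqxx orbT.
have cN : #|link u v| = 2.
  by rewrite (_ : link u v = [set p; q]) ?cards2; [case: eqP | apply/setP].
have no3 a b x y w : x <> y -> y <> w -> w <> x ->
    E a b x -> E a b y -> E a b w -> False.
  move=> /eqP xy /eqP yw /eqP wx ex ey ew.
  have := umax a b; rewrite cN (cardD1 x) (cardD1 y) (cardD1 w) !inE.
  by rewrite ex ey ew wx (eq_sym w) yw (eq_sym y) xy.
(* If [p' = p], then [up] has the three neighbours [v], [z], [z']. So [p] and [q] swap roles for
   [z'], and [vzq], [uz'q], [uzp] form a loose triangle. *)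
have p'q : p' = q.
  have [] := Npq' _ eup; last first.
    move=> pq1; have [] := Npq' _ euq; congruence.
  move=> pp'; subst p'; exfalso.
  by apply: (@no3 u p v z z') => //; try congruence; edge.
have q'p : q' = p by have [] := Npq' _ eup; congruence.
subst p' q'.
by triangle z q u v z' p.
Qed.

Definition star u := forall a b c, E a b c -> [|| a == u, b == u | c == u].
Definition isolated u v := forall a b c, E a b c ->
  (u \in [:: a; b; c]) = (v \in [:: a; b; c]).
Definition two_pairs u v w p := forall a b c, E a b c ->
  [\/ (u \in [:: a; b; c]) && (v \in [:: a; b; c]),
      (w \in [:: a; b; c]) && (p \in [:: a; b; c]) |
      ~~ has (mem [:: a; b; c]) [:: u; v; w; p]].

Lemma edge_through t a b c : E a b c -> t \in [:: a; b; c] ->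
  exists x y, E t x y /\ [:: a; b; c] =i [:: t; x; y].
Proof.
move=> e; rewrite !inE => /or3P[] /eqP ->.
- by exists b, c.
- by exists c, a; split=> [|s]; [edge | rewrite !inE; do !case: eqP].
- by exists a, b; split=> [|s]; [edge | rewrite !inE; do !case: eqP].
Qed.

(** * Links at a pair that forms an edge with every other vertex *)

Section FullPair.
Variables u v : T.
Hypothesis S6 : (6 <= #|S|)%N.
Hypothesis full : forall z, z \in S -> z <> u -> z <> v -> E u v z.

(** Otherwise [u], [v], [w], [p], [q] are distinct, and for a sixth vertex [t] the edge [uvt] closes
    a loose triangle. *)
Lemma full_link_eq w p q : E u w p -> E v w q -> p <> v -> q <> u -> p = q.
Proof.
move=> e1 e2 pv qu; apply/eqP/negPn/negP => /eqP pq.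
have [t tS] := @card_avoid _ S [:: u; v; w; p; q] S6.
rewrite !inE !negb_or => /and5P[/eqP tu /eqP tv /eqP tw /eqP tp /eqP tq].
have e3 := full tS tu tv.
by triangle u w v p q t.
Qed.

(** If [p] were missing from [wxy], the edges [uwp], [wxy], [uvx] would form a loose triangle. *)
Lemma full_link_trace w p x y : E u w p -> w <> v -> p <> v -> E w x y ->
  x <> u -> x <> v -> y <> u -> y <> v -> x = p \/ y = p.
Proof.
move=> e1 wv pv e2 xu xv yu yv.
case: (eqVneq x p) => [|/eqP xp]; first by left.
case: (eqVneq y p) => [|/eqP yp]; first by right.
have e3 : E u v x by apply: full => //; apply: (ES (Erot e2)).
by triangle u w x p y v.
Qed.

(** Used with both orders of [x] and [y], this leaves [vwp] as the only possible edge through [v]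
    avoiding [u]. *)
Lemma full_link_other w p x y : E u w p -> w <> v -> p <> v ->
  E v x y -> x <> u -> y <> u -> x = w \/ x = p.
Proof.
move=> e1 wv pv e2 xu yu.
case: (eqVneq x w) => [|/eqP xw]; first by left.
case: (eqVneq x p) => [|/eqP xp]; first by right.
exfalso.
have wS : w \in S by apply: (ES (Erot e1)).
have xS : x \in S by apply: (ES (Erot e2)).
have wu : w <> u by neqs; congruence.
have xv : x <> v by neqs; congruence.
have euvw := full wS wu wv; have euvx := full xS xu xv.
have [r er] : exists r, E w x r by apply: Ecover => //; congruence.
have yw : y <> w.
  by move=> h; subst; apply: xp; symmetry; apply: (@full_link_eq w) => //; edge.
have yp : y <> p.
  move=> h; subst; apply: xw; symmetry.
  by apply: (@full_link_eq p) => //; edge.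
have ru : r <> u.
  move=> h; subst; apply: yw; symmetry.
  by apply: (@full_link_eq x) => //; edge.
have rv : r <> v.
  move=> h; subst; apply: xp; symmetry.
  by apply: (@full_link_eq w) => //; edge.
(* The edge [wxr] closes a loose triangle with [uwp] and [uvx] if [r] differs from [p], and with
   [uvw] and [vxy] if [r = p]. *)
case: (eqVneq r p) => [rp|/eqP rp]; last by triangle u w x p r v.
by triangle v w x u r y.
Qed.

End FullPair.

(** The only possible edges meeting [uv] in one vertex are [uwp] and [vwp], and by [full_link_trace]
    an edge avoiding [u] and [v] contains both or none of [w], [p]. *)
Lemma full_pair_two_pairs u v w p x y z : (6 <= #|S|)%N ->
  (forall t, t \in S -> t <> u -> t <> v -> E u v t) ->
  E u w p -> w <> v -> p <> v ->
  E x y z -> x <> u -> y <> u -> z <> u -> two_pairs u v w p.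
Proof.
move=> S6 full e1 wv pv e2 xu yu zu.
have full' t : t \in S -> t <> v -> t <> u -> E v u t.
  by move=> tS tv tu; have := full _ tS tu tv => ?; edge.
have traceu := full_link_trace full.
have others := full_link_other S6 full.
have otheru := full_link_other S6 full'.
have wu : w <> u by neqs; congruence.
have pu : p <> u by neqs; congruence.
have e1' : E u p w by edge.
have linkv a b : E v a b -> a <> u -> b <> u -> a = w \/ a = p.
  exact: others e1 wv pv.
have linku a b : E u a b -> a <> v -> b <> v -> a = w \/ a = p.
  (* If [vwp] is an edge, [u] and [v] can be exchanged. If not, every edge at [v] contains [u], and
     the edge [xyz] avoids both. *)
  case evwp : (E v w p); first exact: otheru.
  have nov c d : E v c d -> c <> u -> d <> u -> False.
    move=> e cu du; have e' : E v d c by edge.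
    have := linkv _ _ e cu du; have := linkv _ _ e' du cu.
    move/negP : evwp => evwp [] ? [] ?; subst; neqs; try congruence;
      by apply: evwp; edge.
  have nxv : x <> v by move=> h; subst; exact: (nov y z).
  have nyv : y <> v by move=> h; subst; apply: (nov z x) => //; edge.
  have nzv : z <> v by move=> h; subst; apply: (nov x y) => //; edge.
  (* Some edge through [w] avoids [u] and [v]: [xyz] itself, or an edge covering [wx]. By [traceu]
     it contains [p]. *)
  have [t [ewpt tu tv]] : exists t, [/\ E w p t, t <> u & t <> v].
    have [c [d [ewcd [cu cv] [du dv]]]] :
        exists c d, [/\ E w c d, c <> u /\ c <> v & d <> u /\ d <> v].
      case: (eqVneq w x) => [->|/eqP wx]; first by exists y, z.
      case: (eqVneq w y) => [->|/eqP wy]; first by exists z, x; split=> //; edge.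
      case: (eqVneq w z) => [->|/eqP wz]; first by exists x, y; split=> //; edge.
      have [r er] : exists r, E w x r.
        by apply: Ecover => //; [apply: (ES (Erot e1)) | apply: (ES e2)].
      exists x, r; split=> //; split=> h; subst.
        have e3 : E u x w by edge.
        have [] := traceu _ _ _ _ e3 nxv wv e2; congruence.
      by apply: (nov w x) => //; edge.
    have [h|h] := traceu _ _ _ _ e1 wv pv ewcd cu cv du dv; subst.
      by exists d.
    by exists c; split=> //; edge.
  (* An edge covering [ws] avoids [v] by [nov]; it avoids [u], since tracing [wpt] along [uws] would
     give [s = p] or [s = t]. So [traceu] makes it [wsp]. *)
  have ewp s : s \in S -> s <> u -> s <> v -> s <> w -> s <> p -> E w p s.
    move=> sS su sv sw sp.
    case: (eqVneq s t) => [->//|/eqP st].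
    have [r er] : exists r, E w s r.
      by apply: Ecover => //; [apply: (ES (Erot e1)) | congruence].
    have ru : r <> u.
      move=> h; subst; have e3 : E u w s by edge.
      have [] := traceu _ _ _ _ e3 wv sv ewpt; congruence.
    have rv : r <> v by move=> h; subst; apply: (nov w s) => //; edge.
    have [] := traceu _ _ _ _ e1 wv pv er su sv ru rv; first by [].
    by move=> h; subst; edge.
  move=> eab av bv.
  case: (eqVneq a w) => [|/eqP aw]; first by left.
  case: (eqVneq a p) => [|/eqP ap]; first by right.
  exfalso.
  have au : a <> u by neqs; congruence.
  have aS : a \in S by apply: (ES (Erot eab)).
  have ewpa := ewp _ aS au av aw ap.
  have eawp : E a w p by edge.
  have [s sS] := @card_avoid _ S [:: u; v; w; p; a] S6.
  rewrite !inE !negb_or => /and5P[/eqP su /eqP sv /eqP sw /eqP sp /eqP sa].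
  have ewps := ewp _ sS su sv sw sp.
  (* Tracing [awp] makes [b] one of [w], [p]; tracing [wps] then makes [a] the other one or [s],
     both excluded. *)
  have [h|h] := traceu _ _ _ _ eab av bv eawp wu wv pu pv; subst.
    have e3 : E u b a by edge.
    have [] := traceu _ _ _ _ e3 wv av ewps; congruence.
  have e3 : E u b a by edge.
  have e4 : E b w s by edge.
  have [] := traceu _ _ _ _ e3 pv av e4; congruence.
move=> a b c e.
have [uabc|uabc] := boolP (u \in [:: a; b; c]).
  have [s [t [est mem]]] := edge_through e uabc.
  case vst : (v \in [:: a; b; c]); first by constructor 1.
  constructor 2; move: vst; rewrite !mem !inE => /norP[_ /norP[/eqP vs /eqP vt]].
  have ets : E u t s by edge.
  have := linku _ _ est (nesym vs) (nesym vt).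
  have := linku _ _ ets (nesym vt) (nesym vs).
  by move=> [] ? [] ?; subst; rewrite ?eqxx ?orbT //; neqs; congruence.
have [vabc|vabc] := boolP (v \in [:: a; b; c]).
  have [s [t [est mem]]] := edge_through e vabc.
  constructor 2; move: uabc; rewrite !mem !inE => /norP[_ /norP[/eqP us /eqP ut]].
  have ets : E v t s by edge.
  have := linkv _ _ est (nesym us) (nesym ut).
  have := linkv _ _ ets (nesym ut) (nesym us).
  by move=> [] ? [] ?; subst; rewrite ?eqxx ?orbT //; neqs; congruence.
have [wabc|wabc] := boolP (w \in [:: a; b; c]).
  have [s [t [est mem]]] := edge_through e wabc.
  constructor 2; move: uabc vabc; rewrite !mem !inE.
  move=> /norP[_ /norP[/eqP us /eqP ut]] /norP[_ /norP[/eqP vs /eqP vt]].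
  have [] := traceu _ _ _ _ e1 wv pv est (nesym us) (nesym vs) (nesym ut) (nesym vt);
    by move=> ->; rewrite eqxx ?orbT.
have [pabc|pabc] := boolP (p \in [:: a; b; c]).
  exfalso; have [s [t [est mem]]] := edge_through e pabc.
  move: uabc vabc wabc; rewrite !mem !inE.
  move=> /norP[_ /norP[/eqP us /eqP ut]] /norP[_ /norP[/eqP vs /eqP vt]].
  move=> /norP[_ /norP[/eqP ws /eqP wt]].
  have [] := traceu _ _ _ _ e1' pv wv est (nesym us) (nesym vs) (nesym ut) (nesym vt);
  congruence.
constructor 3; apply/hasPn => t; rewrite !(in_cons, in_nil, orbF) => /or4P[] /eqP ->.
- exact: uabc.
- exact: vabc.
- exact: wabc.
- exact: pabc.
Qed.

Theorem covering_structure : (6 <= #|S|)%N -> exists u v,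
  [/\ u \in S, v \in S, u <> v &
     [\/ star u, isolated u v |
      exists w p, [/\ w \in S, p \in S, uniq [:: u; v; w; p] & two_pairs u v w p]]].
Proof.
move=> S6.
have [x0 x0S _] := @card_avoid _ S [::] (leq_trans (isT : 0 < 6) S6).
have [y0 y0S] := @card_avoid _ S [:: x0] (leq_trans (isT : 1 < 6) S6).
rewrite inE => /eqP yx0.
have [z0 e0] : exists z, E x0 y0 z by apply: Ecover => //; congruence.
have [[u v] /= /andP[uS vS] umax] := @arg_maxnP _ (x0, y0)
  (fun s => (s.1 \in S) && (s.2 \in S)) (fun s => #|link s.1 s.2|)
  (introT andP (conj x0S y0S)).
have {}umax a b : (#|link a b| <= #|link u v|)%N.
  have [abS|abS] := boolP ((a \in S) && (b \in S)); first exact: (umax (a, b)).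
  rewrite (_ : link a b = set0) ?cards0 //; apply/setP => c; rewrite !inE.
  by apply/negP => e; move: abS; rewrite (ES e) (ES (Erot e)).
have uv : u <> v.
  move=> h; have := umax x0 y0; rewrite -h (_ : link u u = set0).
    rewrite cards0 leqn0 => /eqP/cards0_eq/setP/(_ z0).
    by rewrite !inE e0.
  by apply/setP => c; rewrite !inE; apply/negP => e; neqs; congruence.
have full := max_pair_full S6 uS vS uv umax.
have full' t : t \in S -> t <> v -> t <> u -> E v u t.
  by move=> tS tv tu; have := full _ tS tu tv => ?; edge.
(* Used for both orders of the pair; if the third outcome holds for both, then [isolated u v]. *)
have main a b : a \in S -> b \in S -> a <> b ->
    (forall t, t \in S -> t <> a -> t <> b -> E a b t) ->
  [\/ star a,
      exists w p, [/\ w \in S, p \in S, uniq [:: a; b; w; p] & two_pairs a b w p] |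
      forall w p, E a w p -> w = b \/ p = b].
  move=> aS bS ab fab.
  have [/forallP st|] := boolP [forall x, forall y, forall z,
      E x y z ==> [|| x == a, y == a | z == a]].
    by constructor 1 => x y z e; have /forallP/(_ y)/forallP/(_ z)/implyP := st x; apply.
  rewrite negb_forall => /existsP[x]; rewrite negb_forall => /existsP[y].
  rewrite negb_forall => /existsP[z]; rewrite negb_imply !negb_or.
  case/andP=> e /and3P[/eqP xa /eqP ya /eqP za].
  have [/existsP[w /existsP[p /and3P[e1 /eqP wb /eqP pb]]]|] :=
    boolP [exists w, exists p, [&& E a w p, w != b & p != b]].
    constructor 2; exists w, p; split.
    - exact: (ES (Erot e1)).
    - exact: (ES (Erot (Erot e1))).
    - rewrite /= !inE !negb_or !andbT; neqs.
      by do !(apply/andP; split); apply/eqP; congruence.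
    exact: full_pair_two_pairs e xa ya za.
  move=> ne; constructor 3 => w p e1.
  case: (eqVneq w b) => [|wb]; first by left.
  case: (eqVneq p b) => [|pb]; first by right.
  by case/existsP: ne; exists w; apply/existsP; exists p; rewrite e1 wb.
have vu : v <> u by congruence.
have [stu|[w [p [wS pS un tp]]]|nou] := main _ _ uS vS uv full.
- by exists u, v; split=> //; constructor 1.
- by exists u, v; split=> //; constructor 3; exists w, p.
have [stv|[w [p [wS pS un tp]]]|nov] := main _ _ vS uS vu full'.
- by exists v, u; split=> //; constructor 1.
- by exists v, u; split=> //; constructor 3; exists w, p.
exists u, v; split=> //; constructor 2 => a b c e; apply/idP/idP => h.
  have [s [t [est ->]]] := edge_through e h.
  by have [->|->] := nou _ _ est; rewrite !inE eqxx ?orbT.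
have [s [t [est ->]]] := edge_through e h.
by have [->|->] := nov _ _ est; rewrite !inE eqxx ?orbT.
Qed.

End Structure.

(** * Power sums and weights of edges *)

Local Open Scope ring_scope.

Section WeightSum.
Variables (R : realFieldType) (T : finType).
Implicit Types (A e : {set T}) (H : {set {set T}}) (x : T -> R).

Definition monom x e : R := \prod_(i in e) x i.
Definition weight x H : R := \sum_(e in H) monom x e.
Definition total x A : R := \sum_(i in A) x i.
(** [weight x (ksubsets A k)] is the elementary symmetric polynomial of degree [k] in the weights on
    [A]. *)
Definition ksubsets A k : {set {set T}} :=
  [set e : {set T} | (e \subset A) && (#|e| == k)].

Lemma monom_setU1 x a e : a \notin e -> monom x (a |: e) = x a * monom x e.
Proof. by move=> ae; rewrite /monom big_setU1. Qed.

Lemma eq_monom x y e : {in e, x =1 y} -> monom x e = monom y e.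
Proof. by move=> xy; apply: eq_bigr. Qed.

Lemma monom_ge0 x A e : {in A, forall i, 0 <= x i} -> e \subset A -> 0 <= monom x e.
Proof. by move=> x0 /subsetP eA; apply: prodr_ge0 => i /eA/x0. Qed.

Lemma monom_gt0 x A e : {in A, forall i, 0 < x i} -> e \subset A -> 0 < monom x e.
Proof. by move=> x0 /subsetP eA; apply: prodr_gt0 => i /eA/x0. Qed.

(** Deleting [a] is a bijection from the sets containing [a] to the sets avoiding it, and divides
    out the factor [x a]. *)
Lemma sum_monom_mem x a (P : pred {set T}) :
  \sum_(e | P e && (a \in e)) monom x e =
  x a * \sum_(e | P (a |: e) && (a \notin e)) monom x e.
Proof.
rewrite big_distrr /= (reindex_onto (fun e => a |: e) (fun e => e :\ a)) /=.
  apply: eq_big => [e|e /andP[/andP[_ _] /eqP ea]].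
    rewrite setU11 andbT; congr (_ && _); apply/eqP/idP => [<-|ae].
      by rewrite setD11.
    by rewrite setU1K.
  by rewrite monom_setU1 // -ea setD11.
by move=> e /andP[_ ae]; rewrite setD1K.
Qed.

Lemma ksubsets0 A x : weight x (ksubsets A 0) = 1.
Proof.
rewrite /weight (big_pred1 set0) => [|e]; first by rewrite /monom big_set0.
by rewrite inE cards_eq0 /= andbC; case: eqP => // ->; rewrite sub0set.
Qed.

Lemma setU1_ksubsets A a e k : a \in A -> a \notin e ->
  (a |: e \in ksubsets A k.+1) = (e \in ksubsets (A :\ a) k).
Proof.
by move=> aA ae; rewrite !inE cardsU1 ae add1n eqSS subUset sub1set aA subsetD1 ae andbT.
Qed.

Lemma weight_ksubsets_mem x A a k : a \in A ->
  \sum_(e in ksubsets A k.+1 | a \in e) monom x e =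
  x a * weight x (ksubsets (A :\ a) k).
Proof.
move=> aA; rewrite (sum_monom_mem x a (mem (ksubsets A k.+1))); congr (_ * _).
apply: eq_bigl => e; have [ae|ae] := boolP (a \in e).
  by rewrite andbF !inE subsetD1 ae andbF.
by rewrite andbT -setU1_ksubsets.
Qed.

Lemma weight_ksubsetsD1 x A a k : a \in A ->
  weight x (ksubsets A k.+1) =
  weight x (ksubsets (A :\ a) k.+1) + x a * weight x (ksubsets (A :\ a) k).
Proof.
move=> aA; rewrite /weight (bigID (fun e : {set T} => a \in e)) /= addrC.
rewrite weight_ksubsets_mem //; congr (_ + _).
by apply: eq_bigl => e; rewrite !inE subsetD1 -andbA [_ && (a \notin e)]andbC andbA.
Qed.

Lemma totalD1 x A a : a \in A -> total x A = x a + total x (A :\ a).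
Proof. by move=> aA; rewrite /total (big_setD1 a). Qed.

Definition total_pow x A k : R := \sum_(i in A) x i ^+ k.

(** Induction on [#|A|], removing one point by the recurrence [weight_ksubsetsD1]; the factors 2 and
    6 avoid division. *)
Lemma newton_sums x A :
  [/\ weight x (ksubsets A 1) = total x A,
      2 * weight x (ksubsets A 2) = total x A ^+ 2 - total_pow x A 2 &
      6 * weight x (ksubsets A 3) =
        total x A ^+ 3 - 3 * total x A * total_pow x A 2 + 2 * total_pow x A 3].
Proof.
have [m] := ubnP #|A|; elim: m A => // m IH A /ltnSE Am.
have [->|[a aA]] := set_0Vmem A.
  rewrite /total /total_pow !big_set0.
  have z k : weight x (ksubsets set0 k.+1) = 0.
    rewrite /weight big1 // => e; rewrite inE subset0 => /andP[/eqP ->].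
    by rewrite cards0.
  by rewrite !z; split; ring.
have Bm : (#|A :\ a| < m)%N by move: Am; rewrite (cardsD1 a A) aA.
have [IH1 IH2 IH3] := IH _ Bm.
rewrite !(weight_ksubsetsD1 _ _ aA) !(totalD1 _ aA) /total_pow !(big_setD1 a aA) /=.
rewrite -!/(total_pow _ _ _) ksubsets0.
split; first by rewrite IH1; ring.
  rewrite mulrDr mulrCA IH2 IH1; ring.
move: IH2 IH3; set e2 := weight _ _; set e3 := weight _ _ => IH2 IH3.
have -> : 6 * (e3 + x a * e2) = 6 * e3 + 3 * x a * (2 * e2) by ring.
rewrite IH3 IH2; ring.
Qed.

(** Cauchy-Schwarz for [A] padded with zeros to [k] entries: expand the squares around [t / k] and
    bound [#|A|] by [k]. *)
Lemma cauchy_total x A k : (#|A| <= k)%N -> total x A ^+ 2 <= k%:R * total_pow x A 2.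
Proof.
case: k => [|k] Ak.
  have -> : A = set0 by apply/eqP; rewrite -cards_eq0 -leqn0.
  by rewrite /total /total_pow !big_set0 expr0n mul0r.
set t := total x A; set c := t / k.+1%:R.
have k0 : 0 < k.+1%:R :> R by rewrite ltr0n.
have : 0 <= \sum_(i in A) (x i - c) ^+ 2 by apply: sumr_ge0 => i _; exact: sqr_ge0.
have -> : \sum_(i in A) (x i - c) ^+ 2 = total_pow x A 2 - 2 * c * t + #|A|%:R * c ^+ 2.
  transitivity (\sum_(i in A) (x i ^+ 2 + - (2 * c) * x i + c ^+ 2)).
    by apply: eq_bigr => i _; ring.
  rewrite !big_split /= -mulr_sumr sumr_const -[c ^+ 2 *+ _]mulr_natl.
  by rewrite mulNr.
have Ak' : #|A|%:R <= k.+1%:R :> R by rewrite ler_nat.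
move: (#|A|%:R) Ak' => N NK h.
have tc : t = c * k.+1%:R by rewrite /c mulfVK // gt_eqF.
rewrite tc in h *; move: (k.+1%:R) k0 NK h => K k0 NK h.
have : K * 0 <= K * (total_pow x A 2 - 2 * c * (c * K) + N * c ^+ 2) by rewrite ler_pM2l.
have : 0 <= K * (c ^+ 2 * (K - N)).
  by apply: mulr_ge0; [exact: ltW | rewrite mulr_ge0 ?sqr_ge0 ?subr_ge0].
nra.
Qed.


Lemma total_ge0 x A : {in A, forall i, 0 <= x i} -> 0 <= total x A.
Proof. exact: sumr_ge0. Qed.

Lemma weight_le x A H (P : pred {set T}) : {in A, forall i, 0 <= x i} ->
  H \subset ksubsets A 3 -> {subset H <= P} ->
  weight x H <= \sum_(e in ksubsets A 3 | P e) monom x e.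
Proof.
move=> x0 /subsetP HA HP; rewrite /weight big_mkcond [leRHS]big_mkcond /=.
apply: ler_sum => e _; case: ifPn => [eH|_]; first by rewrite (HA _ eH) (HP _ eH : P e).
by case: ifP => // /andP[]; rewrite inE => /andP[eA _] _; apply: monom_ge0 eA.
Qed.

(* With [s], [p2], [p3] the power sums, Cauchy-Schwarz on [A :\ i], multiplied by
   [x i] and summed over [i], gives [s^3 + 5 p3 <= 6 s p2]; then eliminate [p3]
   by Newton's identity. *)
Lemma clique_power_bound x A : {in A, forall i, 0 <= x i} -> (#|A| <= 5)%N ->
  10 * weight x (ksubsets A 3) <= total x A ^+ 3 - total x A * total_pow x A 2.
Proof.
move=> x0 A5.
have h : \sum_(i in A) x i * (total x A - x i) ^+ 2 <=
         \sum_(i in A) x i * (4 * (total_pow x A 2 - x i ^+ 2)).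
  apply: ler_sum => i iA; apply: ler_wpM2l; first exact: x0.
  have := @cauchy_total x (A :\ i) 4.
  have -> : total x (A :\ i) = total x A - x i by rewrite (totalD1 _ iA); ring.
  have -> : total_pow x (A :\ i) 2 = total_pow x A 2 - x i ^+ 2.
    by rewrite /total_pow (big_setD1 i iA) /=; ring.
  by apply; move: A5; rewrite (cardsD1 i) iA.
have hl : \sum_(i in A) x i * (total x A - x i) ^+ 2 =
    total x A ^+ 3 - 2 * total x A * total_pow x A 2 + total_pow x A 3.
  transitivity (\sum_(i in A) (total x A ^+ 2 * x i +
      - (2 * total x A) * x i ^+ 2 + x i ^+ 3)).
    by apply: eq_bigr => i _; ring.
  rewrite !big_split /= -!mulr_sumr -/(total x A) -/(total_pow x A 2).
  by rewrite -/(total_pow x A 3); ring.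
have hr : \sum_(i in A) x i * (4 * (total_pow x A 2 - x i ^+ 2)) =
    4 * (total x A * total_pow x A 2 - total_pow x A 3).
  transitivity (\sum_(i in A) (4 * total_pow x A 2 * x i + (- 4) * x i ^+ 3)).
    by apply: eq_bigr => i _; ring.
  rewrite big_split /= -!mulr_sumr -/(total x A) -/(total_pow x A 3); ring.
rewrite hl hr in h; have [_ _ n3] := newton_sums x A.
by lra.
Qed.

(** Cauchy-Schwarz with five entries leaves at most [4/5] of the cube in [clique_power_bound], and a
    tenth of that is [2/25]. *)
Lemma clique_bound x A : {in A, forall i, 0 <= x i} -> (#|A| <= 5)%N ->
  weight x (ksubsets A 3) <= 2 / 25 * total x A ^+ 3.
Proof.
move=> x0 A5; have := clique_power_bound x0 A5.
have /(ler_wpM2l (total_ge0 x0)) := cauchy_total x A5.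
by rewrite !exprS expr0; lra.
Qed.

(** With four entries the same computation gives [3/40], which is below [2/25]. *)
Lemma clique_bound_lt x A : {in A, forall i, 0 <= x i} -> (#|A| <= 4)%N ->
  0 < total x A -> weight x (ksubsets A 3) < 2 / 25 * total x A ^+ 3.
Proof.
move=> x0 A4 t0; have := clique_power_bound x0 (leqW A4).
have /(ler_wpM2l (total_ge0 x0)) := cauchy_total x A4.
have := exprn_gt0 3 t0; rewrite !exprS expr0; lra.
Qed.

(** Without [u] the edges are pairs in [A :\ u], and Newton's second identity bounds twice their
    weight by the squared total. *)
Lemma star_weight x A H u : {in A, forall i, 0 <= x i} -> u \in A ->
  H \subset ksubsets A 3 -> {in H, forall e : {set T}, u \in e} ->
  2 * weight x H <= x u * total x (A :\ u) ^+ 2.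
Proof.
move=> x0 uA HA Hu.
have := weight_le x0 HA Hu; rewrite weight_ksubsets_mem //.
have [_ n2 _] := newton_sums x (A :\ u).
have p0 : 0 <= total_pow x (A :\ u) 2 by apply: sumr_ge0 => i _; exact: sqr_ge0.
have := x0 _ uA => xu h.
have : x u * (2 * weight x (ksubsets (A :\ u) 2)) <= x u * total x (A :\ u) ^+ 2.
  by apply: ler_wpM2l => //; rewrite n2 gerBl.
by lra.
Qed.

Lemma pair_weight x A u v : u \in A -> v \in A -> u != v ->
  \sum_(e in ksubsets A 3 | (u \in e) && (v \in e)) monom x e =
  x u * (x v * total x (A :\ u :\ v)).
Proof.
move=> uA vA uv; have vAu : v \in A :\ u by rewrite !inE eq_sym uv.
have [<- _ _] := newton_sums x (A :\ u :\ v).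
rewrite -weight_ksubsets_mem // -[LHS]/(\sum_(e | _) _).
rewrite (eq_bigl (fun e => ((e \in ksubsets A 3) && (v \in e)) && (u \in e))); last first.
  by move=> e; rewrite -andbA; congr (_ && _); rewrite andbC.
rewrite sum_monom_mem; congr (_ * _); apply: eq_bigl => e.
have [ue|ue] := boolP (u \in e).
  by rewrite andbF !inE subsetD1 ue andbF.
by rewrite andbT setU1_ksubsets // in_setU1 [v == u]eq_sym (negPf uv).
Qed.

Lemma pair_weight_le x A H u v : {in A, forall i, 0 <= x i} ->
  u \in A -> v \in A -> u != v -> H \subset ksubsets A 3 ->
  {in H, forall e : {set T}, (u \in e) && (v \in e)} ->
  weight x H <= x u * x v * total x (A :\ u :\ v).
Proof.
move=> x0 uA vA uv HA Huv; rewrite -mulrA -pair_weight //.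
exact: weight_le Huv.
Qed.

End WeightSum.

(** * Polynomial inequalities for the three structural cases *)

Section Numeric.
Variable R : realFieldType.
Implicit Types u v w p g r : R.

(** The extremum is at [r = 2u]: the product in [h] equals [4(u + r)^3 - 27ur^2], and
    [4/27 < 4/25]. *)
Lemma star_numeric u r : 0 < u -> 0 <= r -> u * r ^+ 2 < 4 / 25 * (u + r) ^+ 3.
Proof.
move=> u0 r0.
have h : 0 <= (4 * r + u) * (r - 2 * u) ^+ 2.
  by apply: mulr_ge0; [lra | exact: sqr_ge0].
have : 0 < (u + r) ^+ 3 by apply: exprn_gt0; lra.
by nra.
Qed.

(** After bounding [uv] by [a^2 / 4] with [a = u + v], a hundred times the gap is
    [a(8a^2 - ag + 24g^2)]. *)
Lemma isolated_numeric u v g : 0 < u -> 0 < v -> 0 <= g ->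
  u * v * g + 2 / 25 * g ^+ 3 < 2 / 25 * (u + v + g) ^+ 3.
Proof.
move=> u0 v0 g0.
have h : 0 <= (u - v) ^+ 2 * g by rewrite mulr_ge0 // sqr_ge0.
have a0 : 0 < u + v by lra.
have : 0 < (u + v) * (8 * (u + v) ^+ 2 - (u + v) * g + 24 * g ^+ 2).
  apply: mulr_gt0 => //; have := sqr_ge0 (u + v - 2 * g); have := exprn_gt0 2 a0.
  by have := sqr_ge0 g; nra.
by nra.
Qed.

Lemma two_pairs_numeric u v w p g : 0 < u -> 0 < v -> 0 < w -> 0 < p -> 0 <= g ->
  u * v * (w + p + g) + w * p * (u + v + g) + 2 / 25 * g ^+ 3 <
  2 / 25 * (u + v + w + p + g) ^+ 3.
Proof.
move=> u0 v0 w0 p0 g0; set a := u + v; set b := w + p.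
have a0 : 0 < a by rewrite /a; lra.
have b0 : 0 < b by rewrite /b; lra.
(* After bounding [uv] by [a^2 / 4] and [wp] by [b^2 / 4], a hundred times the gap has cubes [8a^3]
   and [8b^3]. Seven of each go here; the last ones absorb [a^2 b + a b^2] in [hab]. *)
have quad c : 0 < c -> 0 < c * (7 * c ^+ 2 - c * g + 24 * g ^+ 2).
  move=> c0; apply: mulr_gt0 => //; have := sqr_ge0 (c - 2 * g).
  by have := exprn_gt0 2 c0; have := sqr_ge0 g; nra.
have hab : 0 <= (a + b) * (a - b) ^+ 2.
  by apply: mulr_ge0; [lra | exact: sqr_ge0].
have habg : 0 <= a * b * g by rewrite !mulr_ge0 // ltW.
have h1 : 0 <= (u - v) ^+ 2 * (b + g) by rewrite mulr_ge0 ?sqr_ge0 //; lra.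
have h2 : 0 <= (w - p) ^+ 2 * (a + g) by rewrite mulr_ge0 ?sqr_ge0 //; lra.
have e1 : 4 * (u * v * (b + g)) = a ^+ 2 * (b + g) - (u - v) ^+ 2 * (b + g).
  by rewrite /a; ring.
have e2 : 4 * (w * p * (a + g)) = b ^+ 2 * (a + g) - (w - p) ^+ 2 * (a + g).
  by rewrite /b; ring.
have qa := quad a a0; have qb := quad b b0.
rewrite (_ : u + v + w + p + g = a + b + g); last by rewrite /a /b; ring.
clearbody a b; lra.
Qed.

End Numeric.

(** * The weight of a system without loose triangles *)

Section TripleSystems.
Variable T : finType.
Implicit Types (S e : {set T}) (H : {set {set T}}).

(** The vertices are in cyclic order: the corners [a], [b], [c] alternate with the vertices lying in
    one edge only. *)
Definition loose_free H := forall a p b q c r, uniq [:: a; p; b; q; c; r] ->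
  [set a; p; b] \in H -> [set b; q; c] \in H -> [set c; r; a] \in H -> False.

Definition has_clique5 H := exists2 K : {set T}, #|K| = 5 & ksubsets K 3 \subset H.

Lemma loose_freeS H H' : H' \subset H -> loose_free H -> loose_free H'.
Proof.
move=> /subsetP HH' free a p b q c r un /HH' h1 /HH' h2 /HH' h3.
exact: free un h1 h2 h3.
Qed.

Lemma has_clique5S H H' : H' \subset H -> has_clique5 H' -> has_clique5 H.
Proof. by move=> HH' [K K5 KH]; exists K => //; apply: subset_trans HH'. Qed.

Lemma set3_mem a b e : a != b -> a \in e -> b \in e -> #|e| = 3 ->
  exists c, e = [set a; b; c].
Proof.
move=> ab ae be e3.
have beA : b \in e :\ a by rewrite !inE eq_sym ab.
have /eqP/cards1P[c ec] : #|e :\ a :\ b| = 1.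
  by apply/eqP; move: e3; rewrite (cardsD1 a) ae (cardsD1 b) beA !add1n => -[->].
by exists c; rewrite -setUA -ec setD1K // setD1K.
Qed.

Lemma card3_set e : #|e| = 3 -> exists a b c, e = [set a; b; c].
Proof.
move=> e3.
have /card_gt1P[a [b [ae be ab]]] : (1 < #|e|)%N by rewrite e3.
by have [c ->] := set3_mem ab ae be e3; exists a, b, c.
Qed.

Lemma set3_rot (a b c : T) : [set a; b; c] = [set b; c; a].
Proof. by rewrite -setUA setUC. Qed.

Lemma set3_seq (a b c t : T) : (t \in [set a; b; c]) = (t \in [:: a; b; c]).
Proof. by rewrite !inE orbA. Qed.

Lemma covering_structure_set S H : H \subset ksubsets S 3 -> loose_free H ->
  {in S &, forall a b, a != b -> exists2 e, e \in H & (a \in e) && (b \in e)} ->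
  (6 <= #|S|)%N ->
  exists u v, [/\ u \in S, v \in S, u != v &
    [\/ {in H, forall e : {set T}, u \in e},
        {in H, forall e : {set T}, (u \in e) = (v \in e)} |
     exists w p, [/\ w \in S, p \in S, uniq [:: u; v; w; p] &
      {in H, forall e : {set T}, [\/ (u \in e) && (v \in e), (w \in e) && (p \in e) |
        [/\ u \notin e, v \notin e, w \notin e & p \notin e]]}]]].
Proof.
move=> /subsetP HS free cover S6.
pose E a b c := [set a; b; c] \in H.
have HE e : e \in H -> exists a b c, e = [set a; b; c] /\ E a b c.
  move=> eH; have := HS _ eH; rewrite inE => /andP[_ /eqP /card3_set[a [b [c ec]]]].
  by exists a, b, c; rewrite /E -ec.
have [] := @covering_structure T S E _ _ _ _ _ _ S6.
- by move=> a b c; rewrite /E [[set a; b]]setUC.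
- by move=> a b c; rewrite /E set3_rot.
- move=> a b c /HS; rewrite inE => /andP[_ /eqP e3] ab; move: e3.
  by rewrite ab setUid cards2; case: eqP.
- by move=> a b c /HS; rewrite inE => /andP[/subsetP-> //]; rewrite !inE eqxx.
- move=> a b aS bS /eqP ab; have [e eH /andP[ae be]] := cover _ _ aS bS ab.
  have := HS _ eH; rewrite inE => /andP[_ /eqP e3].
  by have [c ec] := set3_mem ab ae be e3; exists c; rewrite /E -ec.
- by move=> a p b q c r; apply: free.
move=> u [v [uS vS /eqP uv str]]; exists u, v; split=> //.
case: str => [st|iso|[w [p [wS pS un two]]]].
- constructor 1 => e /HE[a [b [c [-> /st]]]].
  by rewrite !inE !(eq_sym u) orbA.
- by constructor 2 => e /HE[a [b [c [-> /iso]]]]; rewrite !set3_seq.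
constructor 3; exists w, p; split=> // e /HE[a [b [c [-> /two]]]].
rewrite !set3_seq => -[h|h|/hasPn h]; [constructor 1|constructor 2|constructor 3] => //.
by split; apply: h; rewrite !inE eqxx ?orbT.
Qed.

End TripleSystems.

(** * Shifting weight and induction on the support *)

Section Bound.
Variables (R : realFieldType) (T : finType).
Implicit Types (S e : {set T}) (H : {set {set T}}) (x : T -> R).

Lemma weightID x H (P : pred {set T}) :
  weight x H = weight x [set e in H | P e] + weight x [set e in H | ~~ P e].
Proof.
rewrite /weight (bigID P) /=; congr (_ + _).
  by apply: eq_bigl => e; rewrite inE.
by apply: eq_bigl => e; rewrite inE.
Qed.

(** The value at [b] is left as it is, because [b] is then removed from the vertex set. *)
Definition shift x a b i := if i == a then x a + x b else x i.

Lemma total_shift x S a b : a \in S -> b \in S -> a != b ->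
  total (shift x a b) (S :\ b) = total x S.
Proof.
move=> aS bS ab; have aSb : a \in S :\ b by rewrite !inE ab.
rewrite (totalD1 _ aSb) [RHS](totalD1 _ bS) (totalD1 x aSb) {1}/shift eqxx.
rewrite [X in _ + X](_ : _ = total x (S :\ b :\ a)); first by ring.
by apply: eq_bigr => i; rewrite !inE /shift => /andP[/negPf ->].
Qed.

(** The partial derivative of the weight polynomial in the variable of [a]. *)
Definition link_weight x H a := \sum_(e | (a |: e \in H) && (a \notin e)) monom x e.

(** No edge contains both vertices, so the weight is affine along the transfer, with slope the
    difference of the two link weights. *)
Lemma weight_shift x H a b : 0 <= x b -> a != b ->
  {in H, forall e : {set T}, ~~ ((a \in e) && (b \in e))} ->
  link_weight x H b <= link_weight x H a ->
  weight x H <= weight (shift x a b) [set e in H | b \notin e].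
Proof.
move=> xb ab nab leba.
rewrite (weightID x H (fun e => b \in e)).
rewrite [X in X + _ <= _](_ : _ = x b * link_weight x H b).
  rewrite (weightID x _ (fun e => a \in e)).
  rewrite [X in _ <= X](weightID _ _ (fun e => a \in e)).
  have abE e : a |: e \in H -> (b \notin a |: e) by move=> /nab; rewrite setU11.
  have -> : weight x [set e in [set e in H | b \notin e] | a \in e]
      = x a * link_weight x H a.
    rewrite /link_weight -(sum_monom_mem x a (mem H)); apply: eq_bigl => e.
    rewrite !inE -andbA; have [eH|//] := boolP (e \in H).
    by have := nab _ eH; case: (a \in e); rewrite ?andbF //= => ->.
  have -> : weight (shift x a b) [set e in [set e in H | b \notin e] | a \in e]
      = (x a + x b) * link_weight x H a.
    rewrite /weight (eq_bigl (fun e => (e \in H) && (a \in e))); last first.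
      move=> e; rewrite !inE -andbA; have [eH|//] := boolP (e \in H).
      by have := nab _ eH; case: (a \in e); rewrite ?andbF //= => ->.
    rewrite (sum_monom_mem _ a (mem H)) {1}/shift eqxx; congr (_ * _).
    apply: eq_bigr => e /andP[_ ae]; apply: eq_monom => i ie.
    by rewrite /shift; case: eqP => // ia; rewrite -ia ie in ae.
  have -> : weight (shift x a b) [set e in [set e in H | b \notin e] | a \notin e]
      = weight x [set e in [set e in H | b \notin e] | a \notin e].
    apply: eq_bigr => e; rewrite inE => /andP[_ ae]; apply: eq_monom => i ie.
    by rewrite /shift; case: eqP => // ia; rewrite -ia ie in ae.
  by have := ler_wpM2l xb leba; lra.
rewrite /link_weight -(sum_monom_mem x b (mem H)); apply: eq_bigl => e.
by rewrite inE.
Qed.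

(** The homogeneous form lets the induction drop vertices without rescaling; strict positivity on
    [S] makes every missing triple cost weight, which settles equality. *)
Theorem loose_free_weight S H x : H \subset ksubsets S 3 -> loose_free H ->
  {in S, forall i, 0 < x i} ->
  weight x H <= 2 / 25 * total x S ^+ 3 /\
  (0 < total x S -> weight x H = 2 / 25 * total x S ^+ 3 -> has_clique5 H).
Proof.
have [m] := ubnP #|S|; elim: m S H x => // m IH S H x /ltnSE Sm HS free xpos.
have x0 : {in S, forall i, 0 <= x i} by move=> i /xpos/ltW.
have strict : weight x H < 2 / 25 * total x S ^+ 3 ->
    weight x H <= 2 / 25 * total x S ^+ 3 /\
    (0 < total x S -> weight x H = 2 / 25 * total x S ^+ 3 -> has_clique5 H).
  by move=> lt; split=> [|_ eq]; [exact: ltW | rewrite eq ltxx in lt].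
have [S5|S6] := leqP #|S| 5.
  have leH : weight x H <= weight x (ksubsets S 3).
    have := weight_le x0 HS (fun e (_ : e \in H) => isT : e \in predT).
    by rewrite (eq_bigl (mem (ksubsets S 3))) // => e; rewrite andbT.
  split; first exact: le_trans (clique_bound x0 S5).
  move=> t0 eqH; have [S4|S4] := leqP #|S| 4.
    by have := clique_bound_lt x0 S4 t0; rewrite -eqH ltNge leH.
  exists S; first by apply/eqP; rewrite eqn_leq S5.
  (* A missing triple [e0] has a positive monomial, which would keep [H] strictly below the clique
     bound. *)
  apply/subsetP => e0 e0S; apply/negPn/negP => e0H.
  have := clique_bound x0 S5; rewrite -eqH leNgt => /negP; apply.
  rewrite [ltRHS](weightID _ _ (pred1 e0)).
  have -> : weight x [set e in ksubsets S 3 | pred1 e0 e] = monom x e0.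
    rewrite /weight (big_pred1 e0) // => e; rewrite inE /= andbC.
    by case: eqP => // ->.
  have e0pos : 0 < monom x e0.
    by apply: (monom_gt0 xpos); move: e0S; rewrite inE => /andP[].
  have : weight x H <= weight x [set e in ksubsets S 3 | ~~ pred1 e0 e].
    rewrite {2}/weight (eq_bigl (fun e => (e \in ksubsets S 3) && (e != e0))).
      apply: weight_le => // e eH; rewrite unfold_in.
      by apply: contraNneq e0H => <-.
    by move=> e; rewrite inE.
  by lra.
have [/existsP[a /existsP[b /and4P[aS bS ab /forall_inP nab]]]|cov] :=
  boolP [exists a, exists b, [&& a \in S, b \in S, a != b &
    [forall e in H, ~~ ((a \in e) && (b \in e))]]].
  wlog leba : a b aS bS ab nab / link_weight x H b <= link_weight x H a.
    move=> wl; have [le|/ltW le] := leP (link_weight x H b) (link_weight x H a).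
      exact: (wl a b).
    apply: (wl b a) => //; first by rewrite eq_sym.
    by move=> e eH; rewrite andbC nab.
  have leH := weight_shift (x0 _ bS) ab nab leba.
  have H'H : [set e in H | b \notin e] \subset H.
    by apply/subsetP => e; rewrite inE => /andP[].
  have [] := IH (S :\ b) [set e in H | b \notin e] (shift x a b).
  - by apply: leq_trans Sm; rewrite [X in (_ < X)%N](cardsD1 b) bS.
  - apply/subsetP => e; rewrite inE => /andP[/(subsetP HS)].
    by rewrite !inE subsetD1 => /andP[-> ->] ->.
  - exact: loose_freeS free.
  - move=> i; rewrite !inE /shift => /andP[_ iS]; case: ifP => _; last exact: xpos.
    by rewrite addr_gt0 ?xpos.
  (* The transfer keeps the total and does not lower the weight, so equality for [H] forces it for
     the smaller system, whose clique lies in [H]. *)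
  rewrite total_shift // => leH' eqH'; split; first exact: le_trans leH'.
  move=> t0 eqH; apply: has_clique5S H'H _; apply: eqH' => //.
  by apply/eqP; rewrite eq_le leH' -eqH.
have {}cov : {in S &, forall a b, a != b -> exists2 e, e \in H & (a \in e) && (b \in e)}.
  move=> a b aS bS ab; apply/exists_inP; apply: contraR cov.
  rewrite negb_exists_in => nab; apply/existsP; exists a; apply/existsP; exists b.
  by rewrite aS bS ab.
apply: strict.
have [u [v [uS vS uv str]]] := covering_structure_set HS free cov S6.
have vSu : v \in S :\ u by rewrite !inE eq_sym uv.
have xu := xpos _ uS; have xv := xpos _ vS.
have bound S' H' : (#|S'| < #|S|)%N -> S' \subset S -> H' \subset H ->
    H' \subset ksubsets S' 3 -> weight x H' <= 2 / 25 * total x S' ^+ 3.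
  move=> S'S S'subS H'H H'S'; have [] // := IH S' H' x (leq_trans S'S Sm) H'S'.
    exact: loose_freeS free.
  by move=> i /(subsetP S'subS)/xpos.
have tot0 S' : S' \subset S -> 0 <= total x S'.
  by move=> /subsetP S'S; apply: total_ge0 => i /S'S/x0.
have sub (P : pred {set T}) : [set e in H | P e] \subset H.
  by apply/subsetP => e; rewrite inE => /andP[].
have D1S (S' : {set T}) i : S' :\ i \subset S' by rewrite subD1set.
case: str => [st|iso|[w [p [wS pS un two]]]].
- have := star_weight x0 uS HS st.
  have := star_numeric xu (tot0 _ (D1S S u)); rewrite (totalD1 x uS); lra.
- have S'S : S :\ u :\ v \subset S by apply: subset_trans (D1S _ _) (D1S _ _).
  (* Edges through [u] also contain [v]; the others avoid both vertices and fall under [bound]. *)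
  rewrite (weightID x H (fun e => u \in e)).
  have uve : {in [set e in H | u \in e], forall e : {set T}, (u \in e) && (v \in e)}.
    by move=> e; rewrite inE => /andP[eH ue]; rewrite -(iso _ eH) ue.
  have h1 := pair_weight_le x0 uS vS uv (subset_trans (sub _) HS) uve.
  have h2 : weight x [set e in H | u \notin e] <= 2 / 25 * total x (S :\ u :\ v) ^+ 3.
    apply: bound => //.
      by rewrite [X in (_ < X)%N](cardsD1 u) uS (cardsD1 v (S :\ u)) vSu leqW.
    apply/subsetP => e; rewrite inE => /andP[eH ue].
    by have := subsetP HS _ eH; rewrite !inE !subsetD1 -(iso _ eH) ue => /andP[-> ->].
  have := isolated_numeric xu xv (tot0 _ S'S).
  rewrite (totalD1 x uS) (totalD1 x vSu) addrA; lra.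
have := un; rewrite /= !inE !negb_or !andbT.
case/and3P=> [/and3P[_ uw up] /andP[vw vp] wp].
have xw := xpos _ wS; have xp := xpos _ pS.
have wS1 : w \in S :\ u :\ v by rewrite !inE wS eq_sym vw eq_sym uw.
have pS1 : p \in S :\ u :\ v :\ w by rewrite !inE pS eq_sym wp eq_sym vp eq_sym up.
set Y := S :\ u :\ v :\ w :\ p.
have YS : Y \subset S by do 4!apply: subset_trans (D1S _ _) _.
have tS : total x S = x u + x v + x w + x p + total x Y.
  by rewrite (totalD1 x uS) (totalD1 x vSu) (totalD1 x wS1) (totalD1 x pS1) !addrA.
have tuv : total x (S :\ u :\ v) = x w + x p + total x Y.
  by rewrite (totalD1 x wS1) (totalD1 x pS1) !addrA.
have twp : total x (S :\ w :\ p) = x u + x v + total x Y.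
  have pSw : p \in S :\ w by rewrite !inE pS eq_sym wp.
  by have := tS; rewrite (totalD1 x wS) (totalD1 x pSw); lra.
rewrite (weightID x H (fun e => (u \in e) && (v \in e))).
set H' := [set e in H | ~~ _].
(* The edges left after removing those on [uv] and those on [wp] lie in [Y]. *)
rewrite (weightID x H' (fun e => (w \in e) && (p \in e))).
have H'H : H' \subset H by exact: sub.
have h1 : weight x [set e in H | (u \in e) && (v \in e)] <=
    x u * x v * (x w + x p + total x Y).
  rewrite -tuv; apply: pair_weight_le => //; first exact: subset_trans (sub _) HS.
  by move=> e; rewrite inE => /andP[].
have h2 : weight x [set e in H' | (w \in e) && (p \in e)] <=
    x w * x p * (x u + x v + total x Y).
  rewrite -twp; apply: pair_weight_le => //.
    apply: subset_trans HS; apply: subset_trans H'H.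
    by apply/subsetP => e; rewrite inE => /andP[].
  by move=> e; rewrite inE => /andP[].
have h3 : weight x [set e in H' | ~~ ((w \in e) && (p \in e))] <=
    2 / 25 * total x Y ^+ 3.
  apply: bound => //.
  - rewrite [X in (_ < X)%N](cardsD1 u) uS (cardsD1 v (S :\ u)) vSu.
    rewrite (cardsD1 w (S :\ u :\ v)) wS1 (cardsD1 p (S :\ u :\ v :\ w)) pS1.
    by rewrite !add1n -/Y !ltnS; do 3!apply: leqW.
  - by apply: subset_trans H'H; apply/subsetP => e; rewrite inE => /andP[].
  apply/subsetP => e; rewrite !inE => /andP[/andP[eH /negPf nuv] /negPf nwp].
  have := subsetP HS _ eH; rewrite !inE !subsetD1 => /andP[-> ->].
  by have [] := two _ eH; rewrite ?nuv ?nwp // => -[-> -> -> ->].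
have := two_pairs_numeric xu xv xw xp (tot0 _ YS).
by rewrite tS; lra.
Qed.

End Bound.

From mathcomp Require Import all_classical all_reals all_analysis.

Import Order.TTheory GRing.Theory Num.Theory.
Local Open Scope ring_scope.

(** * Lagrangians *)

Lemma subgraph_free_loose_free (n : nat) (G : graph3 n) :
  subgraph_free C33 G -> loose_free (edges G).
Proof.
move=> free a p b q c r un e1 e2 e3; apply: free.
(* The cyclic order puts [a], [b], [c] at positions 0, 2, 4, where consecutive edges of [C33]
   meet. *)
exists (fun i : 'I_6 => nth a [:: a; p; b; q; c; r] i); split=> [i j /eqP|e].
  by rewrite nth_uniq // => /eqP/val_inj.
by rewrite !finset.inE => /orP[/orP[]|] /eqP ->;
  rewrite !finset.imsetU !imset_set1 !inordK.
Qed.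

Lemma contains_complete5 (n : nat) (G : graph3 n) :
  contains (complete3 5) G <-> has_clique5 (edges G).
Proof.
split=> [[f [finj fE]]|[K K5 /fintype.subsetP KE]].
  exists (f @: [set: 'I_5])%SET; first by rewrite card_imset // cardsT card_ord.
  apply/fintype.subsetP => e; rewrite !finset.inE => /andP[/fintype.subsetP eK /eqP e3].
  (* A triple inside the image of [f] is the image of its preimage, which has three elements by
     injectivity. *)
  have ef : (f @: (f @^-1: e))%SET = e.
    apply/finset.setP => i; apply/imsetP/idP => [[j]|ie].
      by rewrite finset.inE => je ->.
    have /imsetP[j _ ij] := eK _ ie.
    by exists j; rewrite // finset.inE -ij.
  by rewrite -ef; apply: fE; rewrite finset.inE -(card_imset _ finj) ef e3.
pose f (i : 'I_5) := enum_val (cast_ord (esym K5) i).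
have finj : injective f by move=> i j /enum_val_inj/cast_ord_inj.
exists f; split=> // e; rewrite finset.inE => /eqP e3.
apply: KE; rewrite finset.inE card_imset // e3 eqxx andbT.
by apply/fintype.subsetP => _ /imsetP[i _ ->]; exact: enum_valP.
Qed.

Section LagrangianBound.
Variables (R : realType) (n : nat) (G : graph3 n).

(** An edge with a vertex of weight 0 contributes nothing, so the weighted bound applies on the
    support, whose total is 1. *)
Lemma loose_free_lagrange_poly (x : 'rV[R]_n) : loose_free (edges G) ->
  std_simplex x -> lagrange_poly G x <= 2 / 25 /\
  (lagrange_poly G x = 2 / 25 -> has_clique5 (edges G)).
Proof.
move=> free [x0 x1]; pose y := x ord0.
pose S := finset (fun i => y i != 0).
pose H := [set e in edges G | e \subset S]%SET.
have HG : H \subset edges G.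
  by apply/fintype.subsetP => e; rewrite finset.inE => /andP[].
have -> : lagrange_poly G x = weight y H.
  rewrite -[lagrange_poly G x]/(weight y (edges G)).
  rewrite (weightID y (edges G) (fun e => e \subset S)) -[RHS]addr0; congr (_ + _).
  apply: big1 => e; rewrite finset.inE => /andP[_ /fintype.subsetPn[i ie iS]].
  rewrite /monom (bigD1 i) //= (_ : y i = 0) ?mul0r //.
  by apply/eqP; move: iS; rewrite finset.inE negbK.
have HS : H \subset ksubsets S 3.
  by apply/fintype.subsetP => e; rewrite !finset.inE => /andP[/card_edge -> ->].
have ypos : {in S, forall i, 0 < y i}.
  by move=> i; rewrite finset.inE lt_def x0 => ->.
have tS : total y S = 1.
  rewrite -x1 /total [RHS](bigID (fun i => y i != 0)) /=.
  rewrite [X in _ = _ + X]big1 ?addr0 => [|i /negPn/eqP //].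
  by apply: eq_bigl => i; rewrite finset.inE.
have [] := loose_free_weight HS (loose_freeS HG free) ypos.
rewrite tS expr1n mulr1 => le eq; split=> // eqH.
by apply: has_clique5S HG _; apply: eq.
Qed.

(** Uniform weight [1/5] on the clique: its ten triples contribute [1/125] each. *)
Lemma clique5_lagrange_poly : has_clique5 (edges G) ->
  exists2 x : 'rV[R]_n, std_simplex x & 2 / 25 <= lagrange_poly G x.
Proof.
move=> [K K5 /fintype.subsetP KG].
pose x : 'rV[R]_n := \row_i (if i \in K then 5^-1 else 0).
have xK i : i \in K -> x ord0 i = 5^-1 by move=> iK; rewrite mxE iK.
have x0 i : 0 <= x ord0 i by rewrite mxE; case: ifP.
exists x.
  split=> //; rewrite (bigID (mem K)) /= [X in _ + X]big1 ?addr0 => [|i /negPf iK].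
    by rewrite (eq_bigr _ xK) sumr_const K5 -[LHS]mulr_natr mulVf // pnatr_eq0.
  by rewrite mxE iK.
have -> : 2 / 25 = weight (x ord0) (ksubsets K 3).
  rewrite /weight (eq_bigr (fun=> 5^-1 ^+ 3)) => [|e].
    by rewrite sumr_const cards_draws K5 -[RHS]mulr_natr (_ : 'C(5, 3) = 10%N) //; lra.
  rewrite finset.inE => /andP[/fintype.subsetP eK /eqP e3].
  by rewrite /monom (eq_bigr (fun=> 5^-1)) ?prodr_const ?e3 // => i /eK/xK.
rewrite /weight /lagrange_poly big_mkcond [leRHS]big_mkcond /=.
apply: ler_sum => e _; case: ifPn => [/KG -> //|_].
by case: ifP => // _; apply: prodr_ge0.
Qed.

Lemma loose_free_lagrangian : loose_free (edges G) ->
  lagrangian R G <= 2 / 25 /\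
  (lagrangian R G = 2 / 25 <-> has_clique5 (edges G)).
Proof.
move=> free; have [n0|n0] := posnP n.
  (* Without vertices the simplex is empty and the supremum takes its default value 0; both sides of
     the equivalence are then false. *)
  have -> : lagrangian R G = 0.
    rewrite /lagrangian (_ : (_ @` _)%classic = set0) ?sup0 //.
    apply/seteqP; split=> // y [x [_ /eqP]].
    rewrite big1 ?(eq_sym 0) ?oner_eq0 // => i; have := ltn_ord i.
    by rewrite [X in (_ < X)%N]n0.
  split; first by lra.
  split=> [|[K K5 _]]; first by lra.
  by have := max_card (mem K); rewrite K5 card_ord n0.
have [x xs [-> xmax]] := lagrangian_max R G n0.
have [le eq] := loose_free_lagrange_poly free xs; do 2!split=> //.
move=> /clique5_lagrange_poly[y ys ley]; apply/eqP.
by rewrite eq_le le (le_trans ley) // xmax.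
Qed.

End LagrangianBound.

Theorem theorem1p10 (R : realType) (n : nat) (G : graph3 n)
    (hG : subgraph_free C33 G) :
  lagrangian R G <= lagrangian R (complete3 5) /\
  lagrangian R (complete3 5) = 2 / 25 /\
  (lagrangian R G = lagrangian R (complete3 5) <-> contains (complete3 5) G).
Proof.
(* A loose triangle needs six vertices, so the general bound applies to the complete 3-graph on five
   vertices and gives its Lagrangian. *)
have K5free : loose_free (edges (complete3 5)).
  move=> a p b q c r un _ _ _; have := max_card (mem [:: a; p; b; q; c; r]).
  by rewrite (card_uniqP un) card_ord.
have [_ /iffRL K5] := loose_free_lagrangian R K5free.
have {}K5 : lagrangian R (complete3 5) = 2 / 25.
  apply: K5; exists [set: 'I_5]%SET; first by rewrite cardsT card_ord.
  by apply/fintype.subsetP => e; rewrite !finset.inE => /andP[].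
have [le eq] := loose_free_lagrangian R (subgraph_free_loose_free hG).
by rewrite K5; do 2!split=> //; rewrite contains_complete5.
Qed.
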